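(* Let $K$ be a real valued field (of any characteristic), $x=(x_1,\dots,x_n)$, and let $f_1,\dots,f_m$ be (non-zero) elements of $K\{x\}^N$. Then for every $f\in K\{x\}^N$ there exist $q_1,\dots,q_m\in K\{x\}$ and an element $r\in K\{x\}^N$ such that $$f=\sum_{j=1}^m q_jf_j+r,$$ having the following two properties: (1) No monomial of $r$ is divisible by $\mathrm{LM}(f_j)$ for $j=1,\dots,m$; $r$ is uniquely determined with this property by the ordered set $f_1,\dots,f_m$. (2) $\mathrm{LM}(f)\ge \mathrm{LM}(q_jf_j)$ for $j=1,\dots,m$ (a condition on those $j$ with $q_jf_j\neq0$).
   Context: A real valued field is a field $K$ with a map $|\ |:K\to\mathbb R_{\ge 0}$ such that $|a|=0\Leftrightarrow a=0$, $|ab|=|a||b|$, $|a+b|\le|a|+|b|$ (the trivial valuation is allowed; $K$ need not be complete). For $f=\sum_{\alpha\in\mathbb N^n}c_\alpha x^\alpha\in K[[x]]$ and $\varepsilon\in(\mathbb R_{>0})^n$ put $\|f\|_\varepsilon=\sum_\alpha|c_\alpha|\varepsilon^\alpha\in\mathbb R_{\ge0}\cup\{\infty\}$; $f$ is convergent if $\|f\|_\varepsilon<\infty$ for some $\varepsilon\in(\mathbb R_{>0})^n$, and $K\{x\}$ is the ring of convergent power series. Monomial ordering (local degree ordering): $x^\alpha>x^\beta$ iff $|\alpha|<|\beta|$, or $|\alpha|=|\beta|$ and for some $l$, $\alpha_1=\beta_1,\dots,\alpha_{l-1}=\beta_{l-1}$, $\alpha_l<\beta_l$ (here $|\alpha|=\alpha_1+\dots+\alpha_n$).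 It is extended to the monomials $x^\alpha e_i$ of $K[[x]]^N$ ($e_1,\dots,e_N$ the canonical basis) by $x^\alpha e_i>x^\beta e_j$ iff $x^\alpha>x^\beta$, or $x^\alpha=x^\beta$ and $i<j$. For $0\ne f\in K[[x]]^N$, the leading monomial $\mathrm{LM}(f)$ is the largest monomial $x^\alpha e_i$ occurring in $f$ with non-zero coefficient. A monomial $x^\beta e_j$ is divisible by $x^\alpha e_i$ if $i=j$ and $x^\alpha\mid x^\beta$. A monomial of an element means a monomial occurring in it with non-zero coefficient.
   Formalization: Uniqueness of r as literally stated fails (f1=xy, f2=xy+y^3, f=xy: r=0 or -y^3); here r is unique among divisions where, for i<j and each monomial x^a of q_j, x^a LM(f_j) is not divisible by LM(f_i); the q_j found satisfy this too. *)

(* Defs.v *)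
From HB Require Import structures.
From mathcomp Require Import all_boot all_order all_algebra.
From mathcomp Require Import mpoly.
From mathcomp Require Import boolp classical_sets reals ereal esum.

Set Implicit Arguments.
Unset Strict Implicit.
Unset Printing Implicit Defensive.

Import Order.TTheory GRing.Theory Num.Theory.

Local Open Scope ring_scope.

Record real_valuation (R : realType) (K : fieldType) (v : K -> R) : Prop :=
  RealValuation {
    rval_ge0 : forall a, 0 <= v a;
    rval_eq0 : forall a, v a = 0 <-> a = 0;
    rvalM : forall a b, v (a * b) = v a * v b;
    rvalD : forall a b, v (a + b) <= v a + v b }.

(* K[[x_1, ..., x_n]]: a series is the function sending an exponent to the
   coefficient of the corresponding monomial. *)
Definition powser (n : nat) (K : fieldType) : Type := 'X_{1..n} -> K.

Section PowserRing.
Variables (n : nat) (K : fieldType).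
Implicit Types (f g h : powser n K) (a : 'X_{1..n}) (p q : {mpoly K[n]}).

HB.instance Definition _ := gen_eqMixin (powser n K).
HB.instance Definition _ := gen_choiceMixin (powser n K).

Definition ps_zero : powser n K := fun=> 0.
Definition ps_opp f : powser n K := fun a => - f a.
Definition ps_add f g : powser n K := fun a => f a + g a.
Definition ps_one : powser n K := fun a => (a == 0%MM)%:R.
(* Every pair (b, c) with b + c = a occurs: deg b and deg c are <= deg a. *)
Definition ps_mul f g : powser n K := fun a =>
  \sum_(k : 'X_{1..n < (mdeg a).+1, (mdeg a).+1} | a == (k.1 + k.2)%MM)
     f k.1 * g k.2.

Lemma ps_addA : associative ps_add.
Proof. by move=> f g h; apply/funext=> a; rewrite /ps_add addrA. Qed.
Lemma ps_addC : commutative ps_add.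
Proof. by move=> f g; apply/funext=> a; rewrite /ps_add addrC. Qed.
Lemma ps_add0 : left_id ps_zero ps_add.
Proof. by move=> f; apply/funext=> a; rewrite /ps_add add0r. Qed.
Lemma ps_addN : left_inverse ps_zero ps_opp ps_add.
Proof. by move=> f; apply/funext=> a; rewrite /ps_add addNr. Qed.

HB.instance Definition _ :=
  GRing.isZmodule.Build (powser n K) ps_addA ps_addC ps_add0 ps_addN.

Definition agree d f p := forall a, (mdeg a < d)%N -> p@_a = f a.

Definition trunc d f : {mpoly K[n]} := \sum_(m : 'X_{1..n < d}) f m *: 'X_[m].

Lemma agree_trunc d f : agree d f (trunc d f).
Proof. by move=> a ad; rewrite mcoeff_mpoly. Qed.

Lemma agree_one d : agree d ps_one 1.
Proof. by move=> a _; rewrite mcoeff1. Qed.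

Lemma agree_add d f g p q :
  agree d f p -> agree d g q -> agree d (ps_add f g) (p + q).
Proof. by move=> fp gq a ad; rewrite mcoeffD fp ?gq. Qed.

Lemma agree_mul d f g p q :
  agree d f p -> agree d g q -> agree d (ps_mul f g) (p * q).
Proof.
move=> fp gq a ad; rewrite mcoeffM; apply: eq_bigr => -[b c] _ /=.
by rewrite fp ?gq //; apply: leq_trans ad; apply: bmdeg.
Qed.

Lemma agree_eq f g : (forall d, exists2 p, agree d f p & agree d g p) -> f = g.
Proof.
move=> fg; apply/funext => a.
by have [p fp gp] := fg (mdeg a).+1; rewrite -fp // -gp.
Qed.

Lemma ps_mulA : associative ps_mul.
Proof.
move=> f g h; apply: agree_eq => d.
exists (trunc d f * (trunc d g * trunc d h)); last rewrite mulrA;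
  by do !apply: agree_mul; apply: agree_trunc.
Qed.

Lemma ps_mulC : commutative ps_mul.
Proof.
move=> f g; apply: agree_eq => d.
exists (trunc d f * trunc d g); last rewrite mulrC;
  by apply: agree_mul; apply: agree_trunc.
Qed.

Lemma ps_mul1 : left_id ps_one ps_mul.
Proof.
move=> f; apply: agree_eq => d.
exists (trunc d f); last exact: agree_trunc.
by rewrite -[trunc d f]mul1r; apply: agree_mul;
  [apply: agree_one|apply: agree_trunc].
Qed.

Lemma ps_mulDl : left_distributive ps_mul ps_add.
Proof.
move=> f g h; apply: agree_eq => d.
exists ((trunc d f + trunc d g) * trunc d h); last rewrite mulrDl.
  by apply: agree_mul; [apply: agree_add|]; apply: agree_trunc.
by apply: agree_add; apply: agree_mul; apply: agree_trunc.
Qed.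

Lemma ps_one_neq0 : ps_one != ps_zero.
Proof.
apply/eqP => /(congr1 (fun f : powser n K => f 0%MM)).
by rewrite /ps_one /ps_zero eqxx => /eqP; rewrite oner_eq0.
Qed.

HB.instance Definition _ := GRing.Zmodule_isComNzRing.Build (powser n K)
  ps_mulA ps_mulC ps_mul1 ps_mulDl ps_one_neq0.

End PowserRing.

Section Convergence.
Variables (R : realType) (K : fieldType) (v : K -> R).

Definition ps_norm (n : nat) (eps : 'I_n -> R) (f : powser n K) : \bar R :=
  \esum_(a in [set: 'X_{1..n}]) (v (f a) * \prod_(i < n) eps i ^+ a i)%:E.

Definition convergent (n : nat) (f : powser n K) : Prop :=
  exists2 eps : 'I_n -> R,
    (forall i, 0 < eps i) & (ps_norm eps f < +oo)%E.

(* Membership in K{x}^N, the radii being allowed to depend on the component. *)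
Definition convergent_vec (n N : nat) (f : 'rV[powser n K]_N) : Prop :=
  forall i, convergent (f 0 i).

End Convergence.

Section LeadingMonomials.
Variable n : nat.

Definition exp_gt (a b : 'X_{1..n}) : bool :=
  (mdeg a < mdeg b)%N ||
  (mdeg a == mdeg b) &&
  [exists l : 'I_n, [forall k : 'I_n, (k < l)%N ==> (a k == b k)] &&
                    (a l < b l)%N].

(* It is the order of the library on exponents, reversed. *)
Lemma exp_gtE (a b : 'X_{1..n}) : exp_gt a b = (a < b)%O.
Proof.
rewrite /exp_gt; case: (ltngtP (mdeg a) (mdeg b)) => [ab|ba|ab] /=.
- by rewrite lt_mdeg_ltmc.
- by rewrite lt_gtF // lt_mdeg_ltmc.
apply/idP/idP => [/existsP[l /andP[/forallP h1 h2]]|/(ltmcP ab)[l h1 h2]].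
  by apply/(ltmcP ab); exists l => // k kl; apply/eqP; exact: (implyP (h1 k)).
apply/existsP; exists l; rewrite h2 andbT; apply/forallP => k.
by apply/implyP => kl; rewrite h1.
Qed.

(* (a, i) stands for the monomial x^a e_i. *)
Definition vmon (N : nat) : Type := ('X_{1..n} * 'I_N)%type.

Variables (K : fieldType) (N : nat).
Implicit Types (f : 'rV[powser n K]_N) (m : vmon N).

Definition vmon_gt m m' : bool :=
  exp_gt m.1 m'.1 || (m.1 == m'.1) && (m.2 < m'.2)%N.

Definition vmon_ge m m' : Prop := m = m' \/ vmon_gt m m'.

Definition vmon_dvd m m' : bool := (m.2 == m'.2) && (m.1 <= m'.1)%MM.

Definition occurs f m : bool := f 0 m.2 m.1 != 0.

(* m = LM(f); no m satisfies this when f = 0. *)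
Definition is_LM f m : Prop :=
  occurs f m /\ forall m', occurs f m' -> vmon_ge m m'.

Lemma is_LM_uniq f m m' : is_LM f m -> is_LM f m' -> m = m'.
Proof.
move=> [fm mmax] [fm' m'max]; case: (mmax _ fm') => // mm'.
case: (m'max _ fm) => // m'm; move: mm' m'm; rewrite /vmon_gt !exp_gtE.
case: (ltgtP m.1 m'.1) => //= _.
by case: ltngtP.
Qed.

Lemma is_LM_exists f : f != 0 -> exists m, is_LM f m.
Proof.
move=> f0.
have [a ha amin] : exists2 a : 'X_{1..n}, (exists i, f 0 i a != 0) &
    forall b, (exists i, f 0 i b != 0) -> (a <= b)%O.
  have [i [a fia]] : exists i a, f 0 i a != 0.
    apply: contrapT => h; case/negP: f0; apply/eqP/rowP => i.
    rewrite mxE; apply/funext => a; apply: contrapT => /eqP fia.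
    by apply: h; exists i, a.
  have : exists i, f 0 i a != 0 by exists i.
  elim/(well_founded_ind (@ltom_wf n)): a {i fia} => a IH ha.
  have [[b [hb ba]]|h] := pselect (exists b, (exists i, f 0 i b != 0) /\
      (b < a)%O); first exact: (IH b).
  exists a => // b hb; rewrite leNgt; apply/negP => ba.
  by apply: h; exists b.
case: ha => i0 hi0.
case: (@arg_minnP _ i0 (fun i => f 0 i a != 0) (@nat_of_ord N) hi0) => i hi imin.
exists (a, i); split => // -[b j] hbj; rewrite /vmon_ge /vmon_gt /= exp_gtE.
have := amin b (ex_intro _ j hbj); rewrite le_eqVlt => /orP[/eqP ab|->].
  2: by right.
rewrite -{}ab in hbj *.
have := imin j hbj; rewrite leq_eqVlt => /orP[/eqP/val_inj ->|ij]; first by left.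
by right; rewrite eqxx ij orbT.
Qed.

Variable k : nat.
Implicit Types (F : 'I_k -> 'rV[powser n K]_N) (q : 'I_k -> powser n K).

Definition remainder_cond F (r : 'rV[powser n K]_N) : Prop :=
  forall j m m', is_LM (F j) m -> occurs r m' -> ~~ vmon_dvd m m'.

(* LM(f) >= LM(q_j f_j) for the j with q_j f_j <> 0; in particular all
   q_j f_j vanish when f = 0. *)
Definition quotient_cond F f q : Prop :=
  forall j m', is_LM (q j *: F j) m' -> exists2 m, is_LM f m & vmon_ge m m'.

(* The normalization by which the ORDERED family F determines the division:
   a multiple of LM(f_j) that is already a multiple of LM(f_i) for some i < j
   is not used by q_j. *)
Definition ordered_quotients F q : Prop :=
  forall (i j : 'I_k) m m' (a : 'X_{1..n}), (i < j)%N ->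
    is_LM (F i) m -> is_LM (F j) m' -> q j a != 0 ->
    ~~ vmon_dvd m ((a + m'.1)%MM, m'.2).

End LeadingMonomials.

(* Main.v *)
(* Split the monomials into the blocks of multiples of LM(f_j) which are not
   multiples of LM(f_i) for i < j, and the rest. Writing
   g = sum_j q_j LT(f_j) + r along this splitting, f = sum_j q_j f_j + r becomes
   the fixed-point equation g = f + T g, where T g = sum_j q_j (LT(f_j) - f_j).
   A positive integer weight can be chosen that makes each leading monomial
   strictly lighter than the other monomials of f_j. Then T g in weight w only
   depends on g in weights < w, so g exists and is unique among formal vectors,
   without completeness of K. Convergence is an a priori bound: with
   |x^a e_k| = t^wt(a, k) and t small, T halves the bounds of the form
   |g_mu| t^wt(mu) <= C, so |f_mu| t^wt(mu) <= A gives
   |g_mu| t^wt(mu) <= 2 A by induction on the weight of mu. *)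

Require Import Defs.
From HB Require Import structures.
From mathcomp Require Import all_boot all_order all_algebra.
From mathcomp Require Import mpoly.
From mathcomp Require Import boolp classical_sets reals ereal esum.
From mathcomp Require Import cardinality fsbigop.
From mathcomp Require Import zify ring lra.

Set Implicit Arguments.
Unset Strict Implicit.
Unset Printing Implicit Defensive.

Import Order.TTheory GRing.Theory Num.Theory.

Local Open Scope ring_scope.

(** * Coefficients of products of power series *)

Section Products.
Variables (n : nat) (K : fieldType).
Implicit Types (f g q : powser n K) (a al : 'X_{1..n}).

Lemma powser_mulE f g a : (f * g) a =
  \sum_(c : 'X_{1..n < (mdeg a).+1} | (c <= a)%MM) f (a - c)%MM * g c.
Proof.
have -> : (f * g) a = (trunc (mdeg a).+1 f * trunc (mdeg a).+1 g)@_a.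
  by rewrite (agree_mul (@agree_trunc _ _ _ f) (@agree_trunc _ _ _ g)).
rewrite (@mcoeff_poly_mul_lin_rev _ _ _ _ _ (mdeg a).+1) //.
apply: eq_bigr => c ca; rewrite !agree_trunc ?bmdeg //.
by rewrite ltnS mdegB.
Qed.

Definition ps_monomial (c : K) al : powser n K := fun b => if b == al then c else 0.

Lemma mul_ps_monomial q c al a :
  (q * ps_monomial c al) a = if (al <= a)%MM then q (a - al)%MM * c else 0.
Proof.
rewrite powser_mulE; case: ifPn => ala; last first.
  rewrite big1 // => b ba; rewrite /ps_monomial; case: eqP => [eb|]; last by rewrite mulr0.
  by rewrite -eb ba in ala.
have dal : (mdeg al < (mdeg a).+1)%N.
  by rewrite ltnS -(submK ala) mdegD leq_addl.
rewrite (bigD1 (BMultinom dal)) //= big1 ?addr0 /ps_monomial ?eqxx // => b /andP[_ nb].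
by rewrite ifN ?mulr0.
Qed.

Lemma powserD f g a : (f + g) a = f a + g a. Proof. by []. Qed.

Lemma powser_sum (I : finType) (G : I -> powser n K) a :
  (\sum_i G i) a = \sum_i G i a.
Proof.
by elim/big_rec2: _ => // i x y _ <-.
Qed.

End Products.

(** * Integer weights compatible with the monomial ordering *)

Section Weight.
Variables (n N D : nat).
Implicit Types (a b : 'X_{1..n}) (m : vmon n N).

(* The digit weights (D+1)^(n-1-i) turn the lexicographic comparison of
   exponents of degree at most D into a comparison of integers; the common
   large summand makes the total degree prevail, and the factor N+1 leaves
   room for the component index as a tie-break. *)
Definition var_wt (i : 'I_n) : nat :=
  (N.+1 * ((D * D.+1 ^ n).+1 + D.+1 ^ (n - i.+1)))%N.
Definition exp_wt a : nat := \sum_(i < n) (var_wt i * a i).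
Definition vmon_wt m : nat := exp_wt m.1 + m.2.

Lemma var_wt_gt0 i : (0 < var_wt i)%N.
Proof. by rewrite /var_wt muln_gt0. Qed.

Lemma exp_wtD a b : exp_wt (a + b)%MM = (exp_wt a + exp_wt b)%N.
Proof.
by rewrite /exp_wt -big_split; apply: eq_bigr => i _; rewrite mnmDE mulnDr.
Qed.

Let digits a := (\sum_(i < n) D.+1 ^ (n - i.+1) * a i)%N.

Lemma exp_wtE a : exp_wt a = (N.+1 * ((D * D.+1 ^ n).+1 * mdeg a + digits a))%N.
Proof.
rewrite mdegE /digits big_distrr -big_split big_distrr; apply: eq_bigr => i _ /=.
by rewrite /var_wt; lia.
Qed.

Lemma digits_le a : (mdeg a <= D)%N -> (digits a <= D * D.+1 ^ n)%N.
Proof.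
move=> aD; apply: leq_trans (leq_mul aD (leqnn _)).
rewrite mdegE big_distrl; apply: leq_sum => i _.
by rewrite mulnC leq_mul2l leq_pexp2l ?leq_subr ?orbT.
Qed.

(** The place [l] decides: since [a] has degree at most D, its later digits contribute at most D
    (D+1)^(n-l-2), less than one unit (D+1)^(n-l-1) at that place. *)
Lemma digits_lt a b (l : 'I_n) : (mdeg a <= D)%N ->
  (forall k : 'I_n, (k < l)%N -> a k = b k) -> (a l < b l)%N ->
  (digits a < digits b)%N.
Proof.
move=> aD eqab ltab; rewrite /digits.
rewrite (bigID (fun i : 'I_n => i < l)%N) [X in (_ < X)%N](bigID (fun i : 'I_n => i < l)%N) /=.
rewrite (eq_bigr _ (fun i il => congr1 (muln _) (eqab i il))) ltn_add2l.
rewrite (bigD1 l) ?ltnn // [X in (_ < X)%N](bigD1 l) ?ltnn //=.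
apply: (@leq_trans (D.+1 ^ (n - l.+1) * (a l).+1)); last first.
  by apply: leq_trans (leq_addr _ _); rewrite leq_mul2l ltab orbT.
rewrite mulnS addnC ltn_add2r.
(* For the last variable there are no later digits; otherwise [n - l.+1] is a genuine successor. *)
have [nl|nl] := posnP (n - l.+1).
  rewrite big1 ?expn_gt0 // => i /andP[]; rewrite -leqNgt => li /eqP il.
  by case: il; apply: val_inj => /=; have := ltn_ord i; lia.
apply: (@leq_ltn_trans (\sum_(i < n) a i * D.+1 ^ (n - l.+2))).
  rewrite big_mkcond; apply: leq_sum => i _; case: ifP => // /andP[].
  rewrite -leqNgt leq_eqVlt => /orP[/eqP/val_inj->|li _]; first by rewrite eqxx.
  by rewrite mulnC leq_mul2l leq_pexp2l ?leq_sub2l ?orbT.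
rewrite -big_distrl /= -mdegE; have -> : (n - l.+1 = (n - l.+2).+1)%N by lia.
by rewrite expnS ltn_mul2r expn_gt0 /= ltnS.
Qed.

(** The degree bound is imposed on the larger monomial [m], so one [D] serves against all the
    infinitely many monomials of a tail. *)
Lemma vmon_wt_lt m m' : (mdeg m.1 <= D)%N -> vmon_gt m m' ->
  (vmon_wt m < vmon_wt m')%N.
Proof.
move=> mD; rewrite /vmon_wt.
case/orP => [|/andP[/eqP-> lt]]; last by rewrite ltn_add2l.
(* Exponent weights are multiples of [N.+1], so a strict inequality leaves a gap that component
   indices, all below [N], cannot undo. *)
move=> gt; suff lt : (exp_wt m.1 + N < exp_wt m'.1)%N.
  apply: leq_trans (leq_addr _ _); apply: leq_trans lt.
  by rewrite ltnS leq_add2l ltnW.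
rewrite !exp_wtE.
suff : ((D * D.+1 ^ n).+1 * mdeg m.1 + digits m.1 <
  (D * D.+1 ^ n).+1 * mdeg m'.1 + digits m'.1)%N by nia.
have := digits_le mD.
case/orP: gt => [lt|/andP[/eqP<- /existsP[l /andP[/forallP h lt]]]].
  by nia.
by rewrite ltn_add2l => _; apply: digits_lt lt => // k kl; apply/eqP/(implyP (h k)).
Qed.

End Weight.

(** * Convergence in terms of weighted sums and of coefficient bounds *)

Section Convergence.
Variables (R : realType) (K : fieldType) (v : K -> R).
Hypothesis hv : real_valuation v.

Lemma rval0 : v 0 = 0. Proof. exact/(rval_eq0 hv). Qed.

Lemma rval_gt0 a : a != 0 -> 0 < v a.
Proof.
move=> a0; rewrite lt_def (rval_ge0 hv) andbT.
by apply: contraNneq a0 => /(rval_eq0 hv) ->.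
Qed.

Lemma rval1 : v 1 = 1.
Proof.
apply: (mulfI (lt0r_neq0 (rval_gt0 (oner_neq0 K)))).
by rewrite -(rvalM hv) !mulr1.
Qed.

Lemma rvalV a : v a^-1 = (v a)^-1.
Proof.
have [->|a0] := eqVneq a 0; first by rewrite invr0 rval0 invr0.
apply: (mulfI (lt0r_neq0 (rval_gt0 a0))).
by rewrite -(rvalM hv) !divff ?rval1 // lt0r_neq0 ?rval_gt0.
Qed.

Lemma rvalN a : v (- a) = v a.
Proof.
apply/eqP; rewrite -(eqrXn2 (n := 2)) ?(rval_ge0 hv) //.
by rewrite !expr2 -!(rvalM hv) mulrNN.
Qed.

Lemma rval_sum (I : Type) (s : seq I) (P : pred I) (G : I -> K) :
  v (\sum_(i <- s | P i) G i) <= \sum_(i <- s | P i) v (G i).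
Proof.
elim/big_rec2: _ => [|i y x _ le]; first by rewrite rval0.
by apply: le_trans (rvalD hv _ _) _; rewrite lerD2l.
Qed.

Lemma finite_pos_lower_bound (I : finType) (e : I -> R) : (forall i, 0 < e i) ->
  exists t : R, [/\ 0 < t, t <= 1 & forall i, t <= e i].
Proof.
move=> e0; exists (\big[Num.min/1]_i e i); split.
- by apply: lt_bigmin.
- exact: bigmin_le_id.
- by move=> i; apply: bigmin_le.
Qed.

Variable n : nat.
Implicit Types (f : powser n K).

(** For t at most 1 and at most every radius [e i], positivity of the weights gives t^(w i) <= t <=
    [e i]; the norm at [e] then bounds all partial sums. *)
Lemma convergent_wt_sum (w : 'I_n -> nat) f : (forall i, 0 < w i)%N ->
  convergent v f -> exists t0 B : R, [/\ 0 < t0, 0 <= B &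
    forall t d, 0 < t -> t <= t0 -> t <= 1 ->
      \sum_(c : 'X_{1..n < d}) v (f c) * t ^+ (\sum_i w i * c i) <= B].
Proof.
move=> w0 [e e0 fe].
have [t0 [t00 _ t0e]] := finite_pos_lower_bound e0.
have term0 a : 0 <= v (f a) * \prod_(i < n) e i ^+ a i.
  by rewrite mulr_ge0 ?(rval_ge0 hv) // prodr_ge0 // => i _; rewrite exprn_ge0 ?ltW.
have fin : ps_norm v e f \is a fin_num.
  by rewrite ge0_fin_numE //; apply: esum_ge0 => a _; rewrite lee_fin.
exists t0, (fine (ps_norm v e f)); split => // [|t d t_gt0 tt0 t1].
  by apply: fine_ge0; apply: esum_ge0 => a _; rewrite lee_fin.
rewrite -lee_fin fineK //; apply: (@le_trans _ _
  (\sum_(c <- [seq bmnm c | c : 'X_{1..n < d}])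
     (v (f c) * \prod_(i < n) e i ^+ c i)%:E)%E); last first.
  rewrite fsbig_seq /=; last first.
    by rewrite map_inj_uniq ?enum_uniq //; apply: val_inj.
  apply: esum_ge; exists [set` [seq bmnm c | c : 'X_{1..n < d}]]%classic => //.
  by split => //; exact: finite_seq.
rewrite big_map big_enum /= sumEFin lee_fin; apply: ler_sum => c _.
rewrite ler_wpM2l ?(rval_ge0 hv) // -prodrXr; apply: ler_prod => i _.
rewrite exprn_ge0 ?(ltW t_gt0) //= exprM lerXn2r ?nnegrE ?exprn_ge0 ?(ltW t_gt0) ?(ltW (e0 i)) //.
apply: le_trans (le_trans tt0 (t0e i)).
by rewrite -{2}[t]expr1 ler_wiXn2l // ltW.
Qed.

Lemma geometric_half_le2 d : \sum_(k < d) (2^-1 : R) ^+ k <= 2.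
Proof.
suff -> : \sum_(k < d) (2^-1 : R) ^+ k = 2 - 2 * 2^-1 ^+ d.
  by have : 0 <= (2^-1 : R) ^+ d; [exact: exprn_ge0|lra].
elim: d => [|d IH]; first by rewrite big_ord0 expr0; ring.
by rewrite big_ord_recr /= IH exprS; field.
Qed.

(** Finitely many exponents lie in a box of side [d], over which the sum factors into [n] geometric
    sums, each at most 2. *)
Lemma sum_geometric_mnm (s : seq 'X_{1..n}) : uniq s ->
  \sum_(a <- s) \prod_(i < n) (2^-1 : R) ^+ a i <= 2 ^+ n.
Proof.
move=> us; pose d := (\max_(a <- s) mdeg a).+1.
have sd a i : a \in s -> (a i < d)%N.
  move=> sa; rewrite ltnS; apply: leq_trans (leq_bigmax_seq _ sa isT).
  by rewrite mdegE (bigD1 i) //= leq_addr.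
pose phi (a : 'X_{1..n}) : {ffun 'I_n -> 'I_d} := [ffun i => inord (a i)].
have phiE a i : a \in s -> phi a i = a i :> nat.
  by move=> sa; rewrite ffunE inordK // sd.
have uphi : uniq (map phi s).
  rewrite map_inj_in_uniq // => a b sa sb ab; apply/mnmP => i.
  by rewrite -(phiE a) // -(phiE b) // ab.
apply: (@le_trans _ _ (\sum_(p : {ffun 'I_n -> 'I_d}) \prod_(i < n) (2^-1 : R) ^+ p i)).
  have -> : \sum_(a <- s) \prod_(i < n) (2^-1 : R) ^+ a i =
      \sum_(p <- map phi s) \prod_(i < n) (2^-1 : R) ^+ p i.
    rewrite big_map big_seq [RHS]big_seq; apply: eq_bigr => a sa.
    by apply: eq_bigr => i _; rewrite phiE.
  rewrite big_uniq // [leRHS](bigID (mem (map phi s))) /= lerDl sumr_ge0 // => p _.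
  by rewrite prodr_ge0 // => i _; rewrite exprn_ge0.
rewrite -(bigA_distr_bigA (fun (_ : 'I_n) (k : 'I_d) => (2^-1 : R) ^+ k)) /=.
apply: (@le_trans _ _ (\prod_(i < n) 2)); last by rewrite prodr_const card_ord.
by apply: ler_prod => i _; rewrite geometric_half_le2 sumr_ge0 // => k _; rewrite exprn_ge0.
Qed.

(** Abel's lemma: after halving the radii, the terms are dominated by [A] times a product of
    geometric series. *)
Lemma convergent_coef_bound (e : 'I_n -> R) A f : (forall i, 0 < e i) ->
  (forall a, v (f a) * \prod_i e i ^+ a i <= A) -> convergent v f.
Proof.
move=> e0 fA; exists (fun i => e i * 2^-1) => [i|]; first by rewrite mulr_gt0.
have A0 : 0 <= A.
  apply: le_trans (fA 0%MM); rewrite mulr_ge0 ?(rval_ge0 hv) // prodr_ge0 // => i _.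
  by rewrite exprn_ge0 ?ltW.
apply: (@le_lt_trans _ _ (A * 2 ^+ n)%:E); last exact: ltry.
apply: ge_ereal_sup => /= _ [X [finX _] <-].
rewrite fsbig_finite //= sumEFin lee_fin.
move: (finmap.enum_fset _) (finmap.fset_uniq (fset_set X)) => s us.
apply: (@le_trans _ _ (\sum_(a <- s) A * \prod_(i < n) (2^-1 : R) ^+ a i)).
  apply: ler_sum => a _.
  under eq_bigr do rewrite exprMn.
  rewrite big_split mulrA; apply: ler_wpM2r => //.
  by rewrite prodr_ge0 // => i _; rewrite exprn_ge0.
by rewrite -mulr_sumr ler_wpM2l // sum_geometric_mnm.
Qed.

End Convergence.

Lemma sumr_neq0 (I : finType) (V : zmodType) (P : pred I) (G : I -> V) :
  \sum_(i | P i) G i != 0 -> exists2 i, P i & G i != 0.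
Proof.
move=> nz; apply: contrapT => h; case/negP: nz; apply/eqP.
rewrite big1 // => i Pi; apply: contrapT => /eqP Gi.
by apply: h; exists i.
Qed.

(** * Transitivity and translation invariance of the module ordering *)

Section MonomialOrder.
Variables n N : nat.
Implicit Types mu nu : vmon n N.

Lemma vmon_ge_trans mu1 mu2 mu3 :
  @vmon_ge n N mu1 mu2 -> vmon_ge mu2 mu3 -> vmon_ge mu1 mu3.
Proof.
case=> [->//|h12] [<-|h23]; right=> //; move: h12 h23; rewrite /vmon_gt !exp_gtE.
case/orP=> [lt12|/andP[/eqP-> lt12]]; case/orP=> [lt23|/andP[/eqP<- lt23]].
- by rewrite (lt_trans lt12 lt23).
- by rewrite lt12.
- by rewrite lt23.
- by rewrite eqxx (ltn_trans lt12 lt23) orbT.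
Qed.

Lemma vmon_gt_add (b : 'X_{1..n}) mu nu : vmon_gt mu nu ->
  @vmon_gt n N ((b + mu.1)%MM, mu.2) ((b + nu.1)%MM, nu.2).
Proof.
rewrite /vmon_gt !exp_gtE /= => /orP[lt|/andP[/eqP-> ->]].
  by rewrite lt_neqAle lemc_add2r (ltW lt) andbT (inj_eq (@addmI _ b)) (lt_eqF lt).
by rewrite eqxx orbT.
Qed.

End MonomialOrder.

(** * Splitting a vector along the blocks of leading monomials *)

Section Division.
Variables (n N m : nat) (K : fieldType) (F : 'I_m -> 'rV[powser n K]_N).
Variable lm : 'I_m -> vmon n N.
Hypothesis lmP : forall j, is_LM (F j) (lm j).
Implicit Types (h g : vmon n N -> K) (mu nu : vmon n N) (j : 'I_m).

Definition lcoef j : K := F j 0 (lm j).2 (lm j).1.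
Definition lm_shift j (b : 'X_{1..n}) : vmon n N := ((b + (lm j).1)%MM, (lm j).2).

Definition in_block j mu : bool :=
  vmon_dvd (lm j) mu && [forall i : 'I_m, (i < j)%N ==> ~~ vmon_dvd (lm i) mu].

Definition block_quot h j : powser n K :=
  fun b => if in_block j (lm_shift j b) then h (lm_shift j b) / lcoef j else 0.
Definition block_rem h mu : K :=
  if [exists j, vmon_dvd (lm j) mu] then 0 else h mu.

(* F j + neg_tail j is the leading term of F j. *)
Definition neg_tail j (k : 'I_N) : powser n K :=
  fun c => if (c, k) == lm j then 0 else - F j 0 k c.

Definition tail_step h mu : K := (\sum_j block_quot h j * neg_tail j mu.2) mu.1.

Lemma lcoef_neq0 j : lcoef j != 0.
Proof. by have [] := lmP j. Qed.

Lemma lead_mulE (q : powser n K) j mu :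
  (q * (F j 0 mu.2 + neg_tail j mu.2)) mu.1 =
  if vmon_dvd (lm j) mu then q (mu.1 - (lm j).1)%MM * lcoef j else 0.
Proof.
have -> : F j 0 mu.2 + neg_tail j mu.2 =
    if (lm j).2 == mu.2 then ps_monomial (lcoef j) (lm j).1 else 0.
  apply/funext => c; rewrite powserD /neg_tail /ps_monomial /lcoef.
  case: (lm j) => a i /=; rewrite xpair_eqE.
  have [->|ni] := eqVneq i mu.2.
    by rewrite andbT; case: eqP => [->|]; rewrite ?addr0 ?subrr.
  by rewrite andbF subrr.
rewrite /vmon_dvd; case: eqP => _ /=; last by rewrite mulr0.
exact: mul_ps_monomial.
Qed.

Lemma neg_tail_gt j k c : neg_tail j k c != 0 -> vmon_gt (lm j) (c, k).
Proof.
rewrite /neg_tail; have [_|ne] := eqVneq (c, k) (lm j); first by rewrite eqxx.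
rewrite oppr_eq0 => Fc; have [_ /(_ (c, k) Fc) []] := lmP j => // e.
by rewrite e eqxx in ne.
Qed.

Lemma in_block_dvd j mu : in_block j mu -> vmon_dvd (lm j) mu.
Proof. by case/andP. Qed.

Lemma in_block_uniq i j mu : in_block i mu -> in_block j mu -> i = j.
Proof.
move=> /andP[di /forallP hi] /andP[dj /forallP hj].
apply: val_inj; case: (ltngtP i j) => // lt.
  by have := implyP (hj i) lt; rewrite di.
by have := implyP (hi j) lt; rewrite dj.
Qed.

Lemma in_block_exists j mu : vmon_dvd (lm j) mu -> exists i, in_block i mu.
Proof.
move=> dj; case: (@arg_minnP _ j (fun i => vmon_dvd (lm i) mu) (@nat_of_ord m) dj).
move=> i di imin; exists i; rewrite /in_block di; apply/forallP => l.
by apply/implyP => li; apply/negP => /imin; rewrite leqNgt li.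
Qed.

Lemma sum_in_block (x : 'I_m -> K) j mu : in_block j mu ->
  \sum_i (if in_block i mu then x i else 0) = x j.
Proof.
move=> bj; rewrite (bigD1 j) //= bj big1 ?addr0 // => i ij.
by case: ifP => // /in_block_uniq /(_ bj) e; rewrite e eqxx in ij.
Qed.

Lemma sum_not_dvd (x : 'I_m -> K) mu : ~~ [exists j, vmon_dvd (lm j) mu] ->
  \sum_i (if in_block i mu then x i else 0) = 0.
Proof.
move=> nd; rewrite big1 // => i _; case: ifP => // /in_block_dvd di.
by case/negP: nd; apply/existsP; exists i.
Qed.

Lemma lm_shiftK j mu : vmon_dvd (lm j) mu -> lm_shift j (mu.1 - (lm j).1)%MM = mu.
Proof.
by case: mu => a k /andP[/= /eqP e ja]; rewrite /lm_shift submK // e.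
Qed.

Lemma vmon_dvd_shift j b : vmon_dvd (lm j) (lm_shift j b).
Proof. by rewrite /vmon_dvd /= eqxx lem_addl. Qed.

(** Adding T h replaces each [F j] by its leading term; the resulting products live on disjoint
    blocks, which together with the rest cover all monomials. *)
Lemma block_decomposition h mu :
  (\sum_j block_quot h j * F j 0 mu.2) mu.1 + tail_step h mu + block_rem h mu =
  h mu.
Proof.
rewrite -powserD -big_split powser_sum.
rewrite (eq_bigr (fun j => if in_block j mu then h mu else 0)); last first.
  move=> j _; rewrite /= -mulrDr lead_mulE; case: ifPn => [d|nd].
    rewrite /block_quot lm_shiftK //; case: ifP => _; last by rewrite mul0r.
    by rewrite divfK ?lcoef_neq0.
  by case: ifP => // /in_block_dvd d; rewrite d in nd.
rewrite /block_rem; case: ifPn => [/existsP[j /in_block_exists[i bi]]|nd].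
  by rewrite (sum_in_block _ bi) addr0.
by rewrite sum_not_dvd ?add0r.
Qed.

Lemma remainder_block_rem (r : 'rV[powser n K]_N) h :
  (forall mu, r 0 mu.2 mu.1 = block_rem h mu) -> remainder_cond F r.
Proof.
move=> rE j mu nu /(is_LM_uniq (lmP j)) <-; rewrite /occurs rE /block_rem.
case: ifPn => [|/existsPn/(_ j) //]; by rewrite eqxx.
Qed.

Lemma ordered_block_quot h : ordered_quotients F (block_quot h).
Proof.
move=> i j mu nu a ij /(is_LM_uniq (lmP i)) <- /(is_LM_uniq (lmP j)) <-.
rewrite /block_quot; case: ifP => [/andP[_ /forallP/(_ i)]|]; last by rewrite eqxx.
by rewrite ij.
Qed.

(** * Recovering a formal vector from a normalized division *)

Section Reconstruction.
Variables (q : 'I_m -> powser n K) (r : 'rV[powser n K]_N).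
Hypotheses (q_ord : ordered_quotients F q) (r_rem : remainder_cond F r).

(** Each [F j] is replaced by its leading term. This inverts the splitting and turns a competing
    division into a solution of the fixed-point equation. *)
Definition reassemble mu : K :=
  (\sum_j q j * (F j 0 mu.2 + neg_tail j mu.2)) mu.1 + r 0 mu.2 mu.1.

Lemma ordered_in_block j b : q j b != 0 -> in_block j (lm_shift j b).
Proof.
move=> qb; rewrite /in_block vmon_dvd_shift; apply/forallP => i.
by apply/implyP => ij; apply: q_ord ij (lmP i) (lmP j) qb.
Qed.

(** The ordering condition confines [q j] times the leading term of [F j] to block [j]. *)
Lemma reassembleE mu : reassemble mu =
  \sum_j (if in_block j mu then q j (mu.1 - (lm j).1)%MM * lcoef j else 0) +
  r 0 mu.2 mu.1.
Proof.
rewrite /reassemble powser_sum; congr (_ + _); apply: eq_bigr => j _.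
rewrite lead_mulE; case: ifPn => [d|nd].
  have [->|/ordered_in_block] := eqVneq (q j (mu.1 - (lm j).1)%MM) 0.
    by rewrite mul0r if_same.
  by rewrite lm_shiftK // => ->.
by case: ifP => // /in_block_dvd d; rewrite d in nd.
Qed.

Lemma block_quot_reassemble j : block_quot reassemble j = q j.
Proof.
apply/funext => b; rewrite /block_quot; case: ifPn => [bj|nb].
  rewrite reassembleE (sum_in_block _ bj) /= addmK.
  have -> : r 0 (lm j).2 (b + (lm j).1)%MM = 0.
    apply: contraTeq (in_block_dvd bj) => nz.
    exact: (r_rem (m' := lm_shift j b) (lmP j)).
  by rewrite addr0 mulfK ?lcoef_neq0.
by apply/esym; apply: contraNeq nb => /ordered_in_block.
Qed.

Lemma block_rem_reassemble mu : block_rem reassemble mu = r 0 mu.2 mu.1.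
Proof.
rewrite /block_rem; case: ifPn => [/existsP[j d]|nd].
  by apply/esym; apply: contraTeq d => nz; apply: (r_rem (lmP j)).
by rewrite reassembleE sum_not_dvd ?add0r.
Qed.

End Reconstruction.

(** * The fixed-point equation g = f + T g over formal vectors *)

Section FixedPoint.
Variable D : nat.
Hypothesis lmD : forall j, (mdeg (lm j).1 <= D)%N.
Let wt mu := vmon_wt D mu.

Lemma tail_stepE h mu : tail_step h mu =
  \sum_j \sum_(c : 'X_{1..n < (mdeg mu.1).+1} | (c <= mu.1)%MM)
     block_quot h j (mu.1 - c)%MM * neg_tail j mu.2 c.
Proof.
by rewrite /tail_step powser_sum; apply: eq_bigr => j _; rewrite powser_mulE.
Qed.

(** Weights are additive, so the gap between the leading monomial and a tail monomial survives
    multiplication by x^b. *)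
Lemma vmon_wt_shift j (b c : 'X_{1..n}) k : neg_tail j k c != 0 ->
  (wt (lm_shift j b) < wt ((b + c)%MM, k))%N.
Proof.
move/neg_tail_gt/(vmon_wt_lt (lmD j)).
by rewrite /wt /vmon_wt /= !exp_wtD -!addnA ltn_add2l.
Qed.

Lemma tail_step_local h g mu :
  (forall nu, (wt nu < wt mu)%N -> h nu = g nu) -> tail_step h mu = tail_step g mu.
Proof.
move=> hg; rewrite !tail_stepE; apply: eq_bigr => j _; apply: eq_bigr => c cmu.
have [->|nz] := eqVneq (neg_tail j mu.2 c) 0; first by rewrite !mulr0.
congr (_ * _); rewrite /block_quot hg //.
by have := vmon_wt_shift (mu.1 - c)%MM nz; rewrite submK //; case: (mu).
Qed.

Lemma wt_ind (P : vmon n N -> Prop) :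
  (forall mu, (forall nu, (wt nu < wt mu)%N -> P nu) -> P mu) -> forall mu, P mu.
Proof.
move=> IH mu; move: {2}(wt mu).+1 (ltnSn (wt mu)) => k.
elim: k mu => // k IHk mu muk; apply: IH => nu numu; apply: IHk.
exact: leq_trans numu muk.
Qed.

Lemma tail_step_fix_uniq f g h : (forall mu, g mu = f mu + tail_step g mu) ->
  (forall mu, h mu = f mu + tail_step h mu) -> g = h.
Proof.
move=> gE hE; apply/funext; elim/wt_ind => mu IH.
by rewrite gE hE (tail_step_local IH).
Qed.

Lemma tail_step_fix_exists f : exists g, forall mu, g mu = f mu + tail_step g mu.
Proof.
pose G k := iter k (fun h mu => f mu + tail_step h mu) (fun=> 0).
(* Each iteration settles one more weight, as T looks only at lighter monomials. *)
have stable k l mu : (wt mu < k)%N -> (wt mu < l)%N -> G k mu = G l mu.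
  elim: k l mu => // k IH [//|l] mu muk mul.
  rewrite /G !iterS -!/(G _); congr (_ + _); apply: tail_step_local => nu numu.
  by apply: IH; apply: leq_trans numu _.
exists (fun mu => G (wt mu).+1 mu) => mu.
rewrite {1}/G iterS -/(G _); congr (_ + _); apply: tail_step_local => nu numu.
exact: stable.
Qed.

(** A monomial of g absent from f comes from a tail monomial of some [F j] times x^b, where x^b LM(F
    j) occurs in g. The latter is lighter, hence covered by induction, and larger in the
    ordering. *)
Lemma fix_occurs_le (f : 'rV[powser n K]_N) g :
  (forall mu, g mu = f 0 mu.2 mu.1 + tail_step g mu) ->
  forall mu, g mu != 0 -> exists2 m, is_LM f m & vmon_ge m mu.
Proof.
move=> gE; elim/wt_ind => mu IH gmu.
have [f_mu|f_mu] := eqVneq (f 0 mu.2 mu.1) 0; last first.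
  have f0 : f != 0.
    by apply: contraNneq f_mu => ->; rewrite mxE.
  have [mf mfP] := is_LM_exists f0.
  by exists mf => //; apply: (mfP.2).
move: gmu; rewrite gE f_mu add0r tail_stepE.
case/sumr_neq0 => j _ /sumr_neq0 [c cmu].
rewrite mulf_eq0 negb_or => /andP[]; rewrite /block_quot.
case: ifP => [_|]; last by rewrite eqxx.
rewrite mulf_eq0 negb_or => /andP[g_nu _] tl.
have lt := vmon_wt_shift (mu.1 - c)%MM tl.
have gt := vmon_gt_add (mu.1 - c)%MM (neg_tail_gt tl).
rewrite submK // in lt gt.
have mu_eta : (mu.1, mu.2) = mu by case: (mu).
rewrite mu_eta in lt gt.
have [mf mfP mf_ge] := IH _ lt g_nu.
by exists mf => //; apply: vmon_ge_trans mf_ge _; right.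
Qed.

(** A nonzero coefficient of [block_quot g j] at b records a monomial x^b LM(F j) of g, at most
    LM(f); every monomial of x^b [F j] is at most that one. *)
Lemma quotient_cond_fix (f : 'rV[powser n K]_N) g :
  (forall mu, g mu = f 0 mu.2 mu.1 + tail_step g mu) ->
  quotient_cond F f (block_quot g).
Proof.
move=> gE j [a k] [occ _]; move: occ.
rewrite /occurs mxE powser_mulE /= => /sumr_neq0 [c ca].
rewrite mulf_eq0 negb_or => /andP[]; rewrite /block_quot.
case: ifP => [_|]; last by rewrite eqxx.
rewrite mulf_eq0 negb_or => /andP[g_nu _] Fc.
have [mf mfP mf_ge] := fix_occurs_le gE g_nu.
exists mf => //; apply: vmon_ge_trans mf_ge _.
have [_ /(_ (val c, k) Fc) [e|gt]] := lmP j.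
  by left; rewrite /lm_shift e /= submK.
by right; have := vmon_gt_add (a - c)%MM gt; rewrite submK.
Qed.

(** * A priori bound for the solution *)

Section Norm.
Variables (R : realType) (v : K -> R).
Hypothesis hv : real_valuation v.
Variables (t A : R) (f g : vmon n N -> K).
Hypotheses (t0 : 0 < t) (gE : forall mu, g mu = f mu + tail_step g mu).
Hypothesis fA : forall mu, v (f mu) * t ^+ wt mu <= A.
(** This makes the norm of T at most 1/2 for the supremum of |g_mu| t^wt(mu). *)
Hypothesis small_tails : forall k d,
  \sum_j (v (lcoef j) * t ^+ wt (lm j))^-1 *
    (\sum_(c : 'X_{1..n < d}) v (neg_tail j k c) * t ^+ wt (val c, k)) <= 2^-1.

(** Passing from [lm_shift j b] to [b] removes the factor v(lcoef j) t^wt(lm j). This serves both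
    the induction on weights and the convergence of the quotients. *)
Lemma block_quot_bound j b x :
  0 <= x -> v (g (lm_shift j b)) * t ^+ wt (lm_shift j b) <= x ->
  v (block_quot g j b) * t ^+ exp_wt N D b <=
    x * (v (lcoef j) * t ^+ wt (lm j))^-1.
Proof.
move=> x0 gx; have lc0 := rval_gt0 hv (lcoef_neq0 j).
rewrite ler_pdivlMr ?mulr_gt0 ?exprn_gt0 // mulrACA -exprD /block_quot.
case: ifP => _; last by rewrite (rval0 hv) !mul0r.
rewrite (rvalM hv) (rvalV hv) divfK ?gt_eqF //; apply: le_trans gx.
by rewrite /wt /vmon_wt /= exp_wtD addnA.
Qed.

Lemma fix_bound mu : v (g mu) * t ^+ wt mu <= 2 * A.
Proof.
have A0 : 0 <= A by apply: le_trans (fA mu); rewrite mulr_ge0 ?(rval_ge0 hv) ?exprn_ge0 ?ltW.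
elim/wt_ind: mu => mu IH.
(* T halves the inductive bound 2A, and the bound A on f restores it. *)
suff step : v (tail_step g mu) * t ^+ wt mu <= A.
  rewrite gE; apply: le_trans (_ : (v (f mu) + v (tail_step g mu)) * t ^+ wt mu <= _).
    by apply: ler_wpM2r; [rewrite exprn_ge0 ?ltW|exact: rvalD].
  by rewrite mulrDl mulrDl mul1r lerD.
apply: le_trans (_ : 2 * A * 2^-1 <= A); last by rewrite mulrAC divff ?mul1r // pnatr_eq0.
apply: le_trans (ler_wpM2l _ (small_tails mu.2 (mdeg mu.1).+1)); last by rewrite mulr_ge0.
rewrite tail_stepE.
apply: le_trans (_ : (\sum_j v (\sum_(c : 'X_{1..n < (mdeg mu.1).+1} | (c <= mu.1)%MM)
     block_quot g j (mu.1 - c)%MM * neg_tail j mu.2 c)) * t ^+ wt mu <= _).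
  by apply: ler_wpM2r; [rewrite exprn_ge0 ?ltW|exact: rval_sum].
rewrite mulr_suml mulr_sumr; apply: ler_sum => j _.
apply: le_trans (_ : (\sum_(c : 'X_{1..n < (mdeg mu.1).+1} | (c <= mu.1)%MM)
     v (block_quot g j (mu.1 - c)%MM * neg_tail j mu.2 c)) * t ^+ wt mu <= _).
  by apply: ler_wpM2r; [rewrite exprn_ge0 ?ltW|exact: rval_sum].
rewrite mulr_suml mulrA mulr_sumr big_mkcond; apply: ler_sum => c _.
have rhs0 : 0 <= 2 * A * (v (lcoef j) * t ^+ wt (lm j))^-1.
  by rewrite !mulr_ge0 // invr_ge0 mulr_ge0 ?(rval_ge0 hv) ?exprn_ge0 ?(ltW t0).
have tl0 : 0 <= v (neg_tail j mu.2 c) * t ^+ wt (val c, mu.2).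
  by rewrite mulr_ge0 ?(rval_ge0 hv) ?exprn_ge0 ?ltW.
case: ifP => cmu; last exact: mulr_ge0.
have [->|tl] := eqVneq (neg_tail j mu.2 c) 0.
  by rewrite mulr0 (rval0 hv) !mul0r mulr0.
have -> : wt mu = (exp_wt N D (mu.1 - c)%MM + wt (val c, mu.2))%N.
  by rewrite /wt /vmon_wt /= addnA -exp_wtD submK.
rewrite (rvalM hv) exprD mulrACA; apply: ler_wpM2r => //.
apply: block_quot_bound; first by rewrite mulr_ge0.
apply: IH; have := vmon_wt_shift (mu.1 - c)%MM tl.
by rewrite submK //; case: (mu).
Qed.

End Norm.
End FixedPoint.
End Division.

(** * Choice of a small radius, and the division theorem *)

Section ConvergentDivision.
Variables (R : realType) (K : fieldType) (v : K -> R).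
Hypothesis hv : real_valuation v.
Variables (n N m : nat).

Lemma convergent_exp_wt D t A (f : powser n K) : 0 < t ->
  (forall a, v (f a) * t ^+ exp_wt N D a <= A) -> convergent v f.
Proof.
move=> t0 fA; apply: (@convergent_coef_bound _ _ _ hv _ (fun i => t ^+ var_wt N D i) A).
  by move=> i; rewrite exprn_gt0.
move=> a; apply: le_trans (fA a); rewrite -prodrXr.
by under eq_bigr do rewrite -exprM.
Qed.

Lemma common_wt_sum D (I : finType) (G : I -> powser n K) :
  (forall i, convergent v (G i)) -> exists t0 B : R,
  [/\ 0 < t0, t0 <= 1, 0 <= B & forall i t d, 0 < t -> t <= t0 ->
    \sum_(c : 'X_{1..n < d}) v (G i c) * t ^+ exp_wt N D c <= B].
Proof.
move=> Gc; have /choice[e /choice[B eB]] i :=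
  convergent_wt_sum hv (@var_wt_gt0 n N D) (Gc i).
have [t0 [t00 t01 t0e]] : exists t, [/\ 0 < t, t <= 1 & forall i, t <= e i].
  by apply: finite_pos_lower_bound => i; have [] := eB i.
exists t0, (\sum_i B i); split=> // [|i t d t_gt0 tt0].
  by apply: sumr_ge0 => i _; have [] := eB i.
have [_ _ /(_ t d t_gt0 (le_trans tt0 (t0e i)) (le_trans tt0 t01)) le] := eB i.
apply: le_trans le _; rewrite (bigD1 i) //= lerDl; apply: sumr_ge0 => k _.
by have [] := eB k.
Qed.

Variables (F : 'I_m -> 'rV[powser n K]_N) (lm : 'I_m -> vmon n N) (D : nat).
Hypotheses (lmP : forall j, is_LM (F j) (lm j))
  (lmD : forall j, (mdeg (lm j).1 <= D)%N)
  (Fc : forall j, convergent_vec v (F j)).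

(* Each tail has weight at least one more than the leading monomial, so
   shrinking t by a factor th gains the factor th on it. *)
Lemma small_tails_exist (f : 'rV[powser n K]_N) : convergent_vec v f ->
  exists t A : R, [/\ 0 < t,
    (forall mu, v (f 0 mu.2 mu.1) * t ^+ vmon_wt D mu <= A) &
    forall k d, \sum_j (v (lcoef F lm j) * t ^+ vmon_wt D (lm j))^-1 *
      (\sum_(c : 'X_{1..n < d})
         v (neg_tail F lm j k c) * t ^+ vmon_wt D (val c, k)) <= 2^-1].
Proof.
move=> fc; pose G (i : 'I_m * 'I_N + 'I_N) :=
  match i with inl jk => F jk.1 0 jk.2 | inr k => f 0 k end.
have Gc i : convergent v (G i) by case: i => [[j k]|k]; [exact: Fc|exact: fc].
have [t1 [B [t10 t11 B0 GB]]] := common_wt_sum D Gc.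
pose w j := (v (lcoef F lm j) * t1 ^+ vmon_wt D (lm j))^-1.
have w0 j : 0 <= w j by rewrite invr_ge0 mulr_ge0 ?(rval_ge0 hv) ?exprn_ge0 ?(ltW t10).
pose S := \sum_j B * w j.
have S0 : 0 <= S by apply: sumr_ge0 => j _; rewrite mulr_ge0.
(* The added 1 keeps the factor defined when S = 0, and still th S <= 1/2. *)
pose th := (2 * (S + 1))^-1.
have th0 : 0 < th by rewrite invr_gt0 mulr_gt0 // ltr_wpDl.
have th1 : th <= 1 by rewrite invf_le1 ?mulr_gt0 ?ltr_wpDl //; lra.
have thS : th * S <= 2^-1.
  rewrite /th invfM -mulrA ler_piMr ?invr_ge0 // mulrC ler_pdivrMr ?ltr_wpDl //.
  by rewrite mul1r lerDl.
have wt_le (t : R) (mu : vmon n N) : 0 < t -> t <= 1 -> t ^+ vmon_wt D mu <= t ^+ exp_wt N D mu.1.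
  by move=> t0 t1'; rewrite ler_wiXn2l ?(ltW t0) ?leq_addr.
have t_gt0 : 0 < th * t1 by rewrite mulr_gt0.
have tt1 : th * t1 <= t1 by rewrite ler_piMl ?(ltW t10).
exists (th * t1), B; split=> // [[a k]|k d] /=.
  apply: le_trans (GB (inr k) _ (mdeg a).+1 t_gt0 tt1).
  apply: le_trans (ler_wpM2l (rval_ge0 hv _) (wt_le _ _ t_gt0 (le_trans tt1 t11))) _.
  rewrite (bigD1 (BMultinom (ltnSn (mdeg a)))) //= lerDl; apply: sumr_ge0 => c _.
  by rewrite mulr_ge0 ?(rval_ge0 hv) ?exprn_ge0 ?(ltW t_gt0).
apply: le_trans thS; rewrite mulr_sumr; apply: ler_sum => j _.
have lc0 := rval_gt0 hv (lcoef_neq0 lmP j).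
(* Scaling t1 by th multiplies the prefactor by th^(-wt(lm j)); the gain th^(wt(lm j)+1) on the tail
   leaves exactly one factor th. *)
have -> : th * (B * w j) = (v (lcoef F lm j) * (th * t1) ^+ vmon_wt D (lm j))^-1 *
    (th ^+ (vmon_wt D (lm j)).+1 * B).
  rewrite /w exprMn exprS; field.
  by rewrite !expf_neq0 ?gt_eqF.
apply: ler_wpM2l.
  by rewrite invr_ge0 mulr_ge0 ?exprn_ge0 ?(ltW t_gt0) ?(ltW lc0).
apply: le_trans (ler_wpM2l _ (GB (inl (j, k)) t1 d t10 (lexx _))); last first.
  by rewrite exprn_ge0 // ltW.
rewrite mulr_sumr; apply: ler_sum => c _.
have [->|tl] := eqVneq (neg_tail F lm j k c) 0.
  rewrite (rval0 hv) mul0r.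
  by rewrite !mulr_ge0 ?(rval_ge0 hv) ?exprn_ge0 ?(ltW t10) ?(ltW th0).
have -> : v (neg_tail F lm j k c) = v (F j 0 k c).
  by move: tl; rewrite /neg_tail; case: ifP => _; rewrite ?eqxx // (rvalN hv).
rewrite mulrCA; apply: ler_wpM2l; first exact: rval_ge0.
rewrite exprMn; apply: ler_pM; rewrite ?exprn_ge0 ?(ltW th0) ?(ltW t10) //.
  rewrite ler_wiXn2l ?(ltW th0) //.
  exact: vmon_wt_lt (lmD j) (neg_tail_gt lmP tl).
exact: wt_le.
Qed.

End ConvergentDivision.

Theorem theorem2p3 (R : realType) (K : fieldType) (v : K -> R)
    (hv : real_valuation v) (n N m : nat) (F : 'I_m -> 'rV[powser n K]_N)
    (hFc : forall j, convergent_vec v (F j)) (hF0 : forall j, F j != 0) :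
  forall f : 'rV[powser n K]_N, convergent_vec v f ->
  exists (q : 'I_m -> powser n K) (r : 'rV[powser n K]_N),
    [/\ (forall j, convergent v (q j)) /\ convergent_vec v r,
        f = \sum_(j < m) q j *: F j + r,
        remainder_cond F r /\
        (ordered_quotients F q /\
         forall (q' : 'I_m -> powser n K) (r' : 'rV[powser n K]_N),
           (forall j, convergent v (q' j)) -> convergent_vec v r' ->
           f = \sum_(j < m) q' j *: F j + r' ->
           remainder_cond F r' -> ordered_quotients F q' -> r' = r)
      & quotient_cond F f q].
Proof.
move=> f fc; have /choice[lm lmP] j := is_LM_exists (hF0 j).
(* With this [D] every leading monomial is lighter than its whole tail. *)
pose D := (\max_j mdeg (lm j).1)%N.
have lmD j : (mdeg (lm j).1 <= D)%N by exact: leq_bigmax.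
have [t [A [t0 fA tails]]] := small_tails_exist hv lmP lmD hFc fc.
have [g gE] := tail_step_fix_exists lmP lmD (fun mu => f 0 mu.2 mu.1).
have g_le := fix_bound lmP lmD hv t0 gE fA tails.
pose q := block_quot F lm g.
pose r : 'rV[powser n K]_N := \row_k (fun a => block_rem lm g (a, k)).
have rE (mu : vmon n N) : r 0 mu.2 mu.1 = block_rem lm g mu by rewrite mxE; case: mu.
have v_ge0 mu : 0 <= v (g mu) * t ^+ vmon_wt D mu.
  by rewrite mulr_ge0 ?(rval_ge0 hv) ?exprn_ge0 ?(ltW t0).
exists q, r; split.
- split=> [j|k].
    apply: (convergent_exp_wt hv t0 (N := N) (D := D)) => b.
    apply: block_quot_bound (g_le _) => //.
    exact: le_trans (v_ge0 (lm_shift lm j b)) (g_le _).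
  (* Weights of vector monomials include the component index [k], hence the division by t^k. *)
  apply: (convergent_exp_wt hv t0 (N := N) (D := D) (A := 2 * A / t ^+ k)) => a.
  rewrite ler_pdivlMr ?exprn_gt0 // -mulrA -exprD (rE (a, k)) /block_rem.
  case: ifP => _; last exact: (g_le (a, k)).
  by rewrite (rval0 hv) mul0r; apply: le_trans (v_ge0 (a, k)) (g_le _).
(* With T g added, both sides equal g: one by the fixed-point equation, the other by the block
   decomposition. *)
- apply/rowP => k; apply/funext => a; apply: (addIr (tail_step F lm g (a, k))).
  rewrite -[LHS](gE (a, k)) -[LHS](block_decomposition lmP g (a, k)).
  rewrite mxE summxE powserD (rE (a, k)) addrAC.
  by under [in RHS]eq_bigr do rewrite mxE.
- split; first exact: (remainder_block_rem lmP rE).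
  split; first exact: (ordered_block_quot lmP).
  (* The competing division reassembles to a solution h of the same equation; formal uniqueness
     gives g = h, and r' is its remainder part. *)
  move=> q' r' _ _ fE r'_rem q'_ord; pose h := reassemble F lm q' r'.
  have quot_h j : block_quot F lm h j = q' j by exact: block_quot_reassemble.
  have hE mu : h mu = f 0 mu.2 mu.1 + tail_step F lm h mu.
    rewrite -[LHS](block_decomposition lmP h mu) (block_rem_reassemble lmP q'_ord r'_rem).
    rewrite fE mxE summxE powserD addrAC.
    under [in RHS]eq_bigr do rewrite mxE.
    by under [in LHS]eq_bigr do rewrite quot_h.
  have gh : g = h by exact: (tail_step_fix_uniq lmP lmD gE hE).
  apply/rowP => k; apply/funext => a.
  by rewrite (rE (a, k)) gh (block_rem_reassemble lmP q'_ord r'_rem).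
- exact: (quotient_cond_fix lmP lmD gE).
Qed.
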